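(* The automorphism group of $M_2^{\mathrm{trop}}$, the moduli space of stable tropical curves of genus $2$ (as a generalized cone complex), is trivial.
   Context: A weighted graph is a finite connected graph $\Gamma$ (loops and multiple edges allowed) with a weight function $w\colon V(\Gamma)\to\mathbb{Z}_{\geq 0}$. Its genus is $b_1(\Gamma)+\sum_v w(v)$. It is stable if $2w(v)-2+\mathrm{val}(v)>0$ for every vertex $v$, where $\mathrm{val}(v)$ counts loops twice. Contracting a non-loop edge merges its endpoints into a vertex whose weight is the sum of the weights of the endpoints; contracting a loop deletes it and increases the weight of its vertex by $1$. For $S\subset E(\Gamma)$, $\Gamma/S$ is the result of contracting all edges in $S$. $\mathrm{Aut}(\Gamma)$ is the group of weight-preserving graph automorphisms; it acts on $E(\Gamma)$. $M_2^{\mathrm{trop}}$ is the colimit of the closed cones $\overline{C}_\Gamma:=\mathbb{R}_{\geq 0}^{E(\Gamma)}$ (with lattice $\mathbb{Z}^{E(\Gamma)}$) over all stable weighted graphs $\Gamma$ of genus $2$, along the maps induced by isomorphisms of weighted graphs and the face inclusions $\mathbb{R}_{\geq0}^{E(\Gamma/S)}\hookrightarrow\mathbb{R}_{\geq 0}^{E(\Gamma)}$ (with image $\{x_e=0 \text{ for } e\in S\}$). As a set it is the disjoint union, over isomorphism classes of stable weighted graphs $\Gamma$ of genus $2$, of the cells $C(\Gamma)=\mathbb{R}_{>0}^{E(\Gamma)}/\mathrm{Aut}(\Gamma)$. A morphism $M_2^{\mathrm{trop}}\to M_2^{\mathrm{trop}}$ of generalized cone complexes is a continuous map such that for each $\Gamma$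 the composition $\overline{C}_\Gamma\to M_2^{\mathrm{trop}}\to M_2^{\mathrm{trop}}$ factors through some canonical map $\overline{C}_{\Gamma'}\to M_2^{\mathrm{trop}}$ via a map $\overline{C}_\Gamma\to\overline{C}_{\Gamma'}$ that is the restriction of an integral linear map. An automorphism is a morphism with an inverse that is also a morphism. *)

(* Defs.v *)
From HB Require Import structures.
From mathcomp Require Import all_boot all_order all_algebra.
From mathcomp Require Import generic_quotient.
From mathcomp Require Import all_classical all_reals all_analysis.
From Stdlib Require Import Relation_Operators.

Set Implicit Arguments.
Unset Strict Implicit.
Unset Printing Implicit Defensive.

Import Order.TTheory GRing.Theory Num.Theory.
Import numFieldNormedType.Exports.

Local Open Scope classical_set_scope.
Local Open Scope ring_scope.
Local Open Scope quotient_scope.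

(* Each edge carries an auxiliary orientation, which isomorphisms ignore. *)
Record wgraph := WGraph {
  vertex : finType;
  edge : finType;
  src : edge -> vertex;
  tgt : edge -> vertex;
  weight : vertex -> nat }.

Section Invariants.
Variable G : wgraph.

Definition adj : rel (vertex G) := fun u v =>
  [exists e : edge G, ((src e == u) && (tgt e == v))
                   || ((src e == v) && (tgt e == u))].

Definition ncomp : nat := n_comp adj (vertex G).

Definition valence (v : vertex G) : nat :=
  (\sum_(e : edge G) ((src e == v) + (tgt e == v)))%N.

(* b_1 = #E - #V + #components; the subtraction never truncates. *)
Definition betti1 : nat := (#|edge G| + ncomp - #|vertex G|)%N.

Definition genus : nat := (betti1 + \sum_(v : vertex G) weight v)%N.

(* One component: connected and nonempty.  The stability inequality is
   2 w(v) - 2 + val(v) > 0 with the subtraction moved across, since [nat]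
   subtraction truncates. *)
Definition stable_of_genus (g : nat) : bool :=
  [&& ncomp == 1%N, genus == g
    & [forall v : vertex G, (2 < 2 * weight v + valence v)%N]].

End Invariants.

Definition is_iso (G H : wgraph) (fV : vertex G -> vertex H)
    (fE : edge G -> edge H) : Prop :=
  [/\ bijective fV, bijective fE,
      forall v, weight (fV v) = weight v
    & forall e, (src (fE e) = fV (src e) /\ tgt (fE e) = fV (tgt e))
             \/ (src (fE e) = fV (tgt e) /\ tgt (fE e) = fV (src e))].

(* Contraction of the edge e.  When e is not a loop, [tgt e] is removed and
   [src e] stands for the merged vertex; when e is a loop no vertex is
   removed. *)
Section ContractEdge.
Variables (G : wgraph) (e : edge G).

Definition is_loop : bool := src e == tgt e.

Definition ce_vertex : finType := {v : vertex G | (v != tgt e) || is_loop}.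

Definition ce_edge : finType := {f : edge G | f != e}.

Definition ce_merge (v : vertex G) : vertex G :=
  if v == tgt e then src e else v.

Lemma ce_merge_subproof v : (ce_merge v != tgt e) || is_loop.
Proof. by rewrite /ce_merge /is_loop; case: ifP => [_|->//]; rewrite orNb. Qed.

Definition ce_proj (v : vertex G) : ce_vertex :=
  exist _ (ce_merge v) (ce_merge_subproof v).

Definition ce_weight (v : ce_vertex) : nat :=
  if val v == src e then
    if is_loop then (weight (src e)).+1
    else (weight (src e) + weight (tgt e))%N
  else weight (val v).

Definition contract_edge : wgraph :=
  @WGraph ce_vertex ce_edge (fun f => ce_proj (src (val f)))
    (fun f => ce_proj (tgt (val f))) ce_weight.

End ContractEdge.

(* The graph G/S, obtained by contracting the edges of S one after the other,
   together with the inclusion of its edge set into that of G.  The [nat]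
   argument bounds the number of steps; #|S| steps exhaust S. *)
Fixpoint contract_rec (k : nat) (G : wgraph) (S : {set edge G}) :
    {H : wgraph & edge H -> edge G} :=
  let stop := existT (fun H => edge H -> edge G) G id in
  if k is k'.+1 then
    if [pick e in S] is Some e then
      let r := contract_rec k'
        [set f : edge (contract_edge e) | (val f : edge G) \in S]%SET in
      existT (fun H => edge H -> edge G) (projT1 r)
        (fun f => val (projT2 r f))
    else stop
  else stop.

Definition contraction (G : wgraph) (S : {set edge G}) : wgraph :=
  projT1 (contract_rec #|S| S).

Definition contraction_incl (G : wgraph) (S : {set edge G}) :
  edge (contraction S) -> edge G := projT2 (contract_rec #|S| S).

(* To index a colimit by a small type, we restrict to the graphs whose vertex
   and edge sets are ordinals; every finite graph is isomorphic to such a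
   graph. *)
Record ograph := OGraph {
  nvertex : nat;
  nedge : nat;
  osrc : 'I_nedge -> 'I_nvertex;
  otgt : 'I_nedge -> 'I_nvertex;
  oweight : 'I_nvertex -> nat }.

HB.instance Definition _ := gen_eqMixin ograph.
HB.instance Definition _ := gen_choiceMixin ograph.

Definition wgraph_of (G : ograph) : wgraph :=
  WGraph (@osrc G) (@otgt G) (@oweight G).

Definition stable_graph (g : nat) : choiceType :=
  {G : ograph | stable_of_genus (wgraph_of G) g}.

Definition graph_of (g : nat) (G : stable_graph g) : wgraph :=
  wgraph_of (val G).

Section Mtrop.
Variables (R : realType) (g : nat).

Definition cone (G : stable_graph g) : topologicalType :=
  [set x : {ptws edge (graph_of G) -> R} | forall e, 0 <= x e].

Definition coords (G : stable_graph g) (x : cone G) :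
  edge (graph_of G) -> R := set_val x.

Definition cones : topologicalType := {G : stable_graph g & cone G}.

(* The arrows of the colimit diagram are the composites of an isomorphism
   G' ~ G/S with the face inclusion of G/S into G (S empty gives the
   isomorphisms).  [glue_step p q] says that such an arrow sends q to p: the
   coordinates of p are those of q on the edges of G/S and 0 on S. *)
Definition glue_step (p q : cones) : Prop :=
  exists (S : {set edge (graph_of (projT1 p))})
    (fV : vertex (graph_of (projT1 q)) -> vertex (contraction S))
    (fE : edge (graph_of (projT1 q)) -> edge (contraction S)),
    [/\ is_iso fV fE,
        forall e, coords (projT2 p) (contraction_incl (fE e))
                  = coords (projT2 q) e
      & forall e, e \in S -> coords (projT2 p) e = 0].

Definition glued : rel cones :=
  fun p q => `[< clos_refl_sym_trans cones glue_step p q >].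

Lemma glued_refl : reflexive glued.
Proof. by move=> p; apply/asboolP; exact: rst_refl. Qed.

Lemma glued_sym : symmetric glued.
Proof.
by move=> p q; apply/idP/idP => /asboolP pq; apply/asboolP; exact: rst_sym.
Qed.

Lemma glued_trans : transitive glued.
Proof.
by move=> q p r /asboolP pq /asboolP qr; apply/asboolP; exact: rst_trans qr.
Qed.

Canonical glued_equiv := EquivRel glued glued_refl glued_sym glued_trans.

(* The tropical moduli space M_g^trop, with the quotient topology. *)
Definition Mtrop : topologicalType := quotient_topology {eq_quot glued_equiv}.

Definition cone_map (G : stable_graph g) (x : cone G) : Mtrop :=
  \pi_{eq_quot glued_equiv} (existT cone G x : cones).

Definition integral_linear (A B : finType) (L : (A -> R) -> (B -> R)) : Prop :=
  linear L /\
  forall x : A -> R, (forall a, x a \is a Num.int) ->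
    forall b, L x b \is a Num.int.

Definition is_morphism (f : Mtrop -> Mtrop) : Prop :=
  continuous f /\
  forall G : stable_graph g, exists (G' : stable_graph g)
    (L : (edge (graph_of G) -> R) -> (edge (graph_of G') -> R))
    (l : cone G -> cone G'),
    [/\ integral_linear L,
        forall x, coords (l x) = L (coords x)
      & forall x, f (cone_map x) = cone_map (l x)].

Definition is_automorphism (f : Mtrop -> Mtrop) : Prop :=
  is_morphism f /\
  exists h : Mtrop -> Mtrop, [/\ is_morphism h, cancel f h & cancel h f].

Definition Mtrop_aut : set (Mtrop -> Mtrop) := [set f | is_automorphism f].

End Mtrop.

Arguments Mtrop_aut : clear implicits.

(* Main.v *)
Require Import Defs.
From HB Require Import structures.
From mathcomp Require Import all_boot all_order all_algebra.
From mathcomp Require Import perm generic_quotient.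
From mathcomp Require Import all_classical all_reals all_analysis.
From mathcomp Require Import zify lra.
From Stdlib Require Import Relation_Operators.
(* The graph-theoretic [contraction] has to take precedence over the homonymous
   notion for metric spaces. *)
Require Import Defs.

Set Implicit Arguments.
Unset Strict Implicit.
Unset Printing Implicit Defensive.

Import Order.TTheory GRing.Theory Num.Theory.

Local Open Scope ring_scope.

(** Every stable graph of genus 2 is a contraction of the theta graph or of the
    dumbbell graph ([face_theta_or_dumbbell]), so the moduli space is covered by
    the cones of these two graphs, glued along the cone of the figure eight.

    The rigidity comes from the total length of a curve, a well-defined function
    on the moduli space.  On each cone an automorphism f is a matrix of
    nonnegative integers, and no column vanishes because f is injective.  Hence
    f does not decrease the total length ([total_length_le]), and neither does
    its inverse, so f preserves it.  Every column then has sum 1: f is induced by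
    a map between edge sets ([automorphism_push]).  That map is injective,
    because the number of edges of positive length is also an invariant
    ([push_injective]); composed with the inclusion of the target as a face of
    the theta graph or of the dumbbell, it becomes a bijection when the source
    is one of these two graphs.

    It remains to see that edges go to edges of the same kind.  The curves with
    a single edge of length 1 coming from a trivalent graph form just two points:
    the loop, which is every ray of the theta cone and two rays of the dumbbell
    cone, and the bridge.  They differ, because having a bridge of positive
    length is an invariant ([has_bridge_invariant]).  A theta cone mapped onto a
    dumbbell cone would send equal rays to different ones, so f is the identity
    on the theta cone ([automorphism_theta]).  The loop is thus fixed, the
    bridge can only go to the bridge, and f is the identity on the dumbbell cone
    as well ([automorphism_dumbbell]). *)

(** * Cuts and bridges under contraction *)

Definition cut (G : wgraph) (c : vertex G -> bool) : pred (edge G) :=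
  fun e => c (src e) != c (tgt e).

(** For a connected graph, this says that deleting [e] disconnects it.  Cuts are
    preferred to deletion because they pull back along contractions. *)
Definition bridge (G : wgraph) (e : edge G) : Prop :=
  exists c : vertex G -> bool, cut c =1 pred1 e.

Lemma ce_proj_tgt (G : wgraph) (e : edge G) :
  ce_proj e (src e) = ce_proj e (tgt e).
Proof. by apply: val_inj; rewrite /= /ce_merge eqxx; case: ifP. Qed.

Lemma cut_ce_lift (G : wgraph) (e : edge G) (c : vertex (contract_edge e) -> bool) :
  ~~ cut (fun v => c (ce_proj e v)) e.
Proof. by rewrite /cut ce_proj_tgt eqxx. Qed.

Lemma cut_ce_restrict (G : wgraph) (e : edge G) (c : vertex G -> bool) :
  ~~ cut c e -> forall f : edge (contract_edge e),
  cut (fun v : vertex (contract_edge e) => c (val v)) f = cut c (val f).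
Proof.
rewrite /cut negbK => /eqP ce f.
have cm v : c (ce_merge e v) = c v by rewrite /ce_merge; case: eqP => [->|].
by rewrite /= !cm.
Qed.

(** What contracting [S] keeps track of, beyond the vertices: the surviving
    edges are those outside [S], and the cuts of the contracted graph are the
    cuts of [G] that avoid [S]. *)
Definition contracts (G H : wgraph) (S : {set edge G})
    (incl : edge H -> edge G) : Prop :=
  [/\ injective incl,
      forall e, incl e \notin S,
      forall e, e \notin S -> exists e', incl e' = e,
      forall c : vertex H -> bool,
        exists2 c' : vertex G -> bool, forall e, e \in S -> ~~ cut c' e
          & forall e, cut c' (incl e) = cut c e
    & forall c : vertex G -> bool, (forall e, e \in S -> ~~ cut c e) ->
        exists c' : vertex H -> bool, forall e, cut c' e = cut c (incl e)].

Lemma contracts_set0 (G : wgraph) :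
  @contracts G G finset.set0 id.
Proof.
split=> // [e|e _|c|c _]; first by rewrite finset.in_set0.
- by exists e.
- by exists c => // e; rewrite finset.in_set0.
- by exists c.
Qed.

Lemma contracts_step (G H : wgraph) (S : {set edge G}) (e : edge G)
    (incl : edge H -> edge (contract_edge e)) :
  e \in S ->
  contracts [set f : edge (contract_edge e) | val f \in S]%SET incl ->
  contracts S (fun f => val (incl f)).
Proof.
set S' := [set f | _]%SET => eS [inj im surj lift res].
have inS' (f : edge (contract_edge e)) : (f \in S') = (val f \in S) by rewrite inE.
split.
- by move=> f1 f2 /val_inj; apply: inj.
- by move=> f; rewrite -inS'.
- move=> f fS; have fe : f != e by apply: contraNneq fS => ->.
  have [|f' ff'] := surj (exist _ f fe); first by rewrite inS'.
  by exists f'; rewrite ff'.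
- move=> c; have [c' c'S c'c] := lift c.
  exists (fun v => c' (ce_proj e v)).
    move=> f fS; have [->|fe] := eqVneq f e; first exact: cut_ce_lift.
    by apply: (c'S (exist _ f fe)); rewrite inS'.
  by move=> f; rewrite -c'c.
- move=> c cS; have ce := cS e eS.
  have [|c' c'c] := res (fun v => c (val v)).
    by move=> f; rewrite inS' cut_ce_restrict //; apply: cS.
  by exists c' => f; rewrite c'c cut_ce_restrict.
Qed.

Lemma contract_recP (k : nat) (G : wgraph) (S : {set edge G}) :
  (#|S| <= k)%N -> contracts S (projT2 (contract_rec k S)).
Proof.
elim: k G S => [|k IH] G S leS /=.
  have -> : S = finset.set0 by apply/eqP; rewrite -cards_eq0; lia.
  exact: contracts_set0.
case: pickP => [e eS|S0] /=; last first.
  have -> : S = finset.set0.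
    by apply/setP => e; rewrite finset.in_set0; have := S0 e.
  exact: contracts_set0.
apply: contracts_step => //; apply: IH; set S' := [set f | _]%SET.
have /subset_leq_card : [set val f | f in S']%SET \subset (S :\ e)%SET.
  apply/fintype.subsetP => _ /imsetP[f fS' ->].
  by rewrite !inE (valP f); rewrite inE in fS'.
rewrite card_imset; last exact: val_inj.
by move/leq_trans; apply; move: leS; rewrite (cardsD1 e) eS add1n ltnS.
Qed.

Lemma contractionP (G : wgraph) (S : {set edge G}) :
  contracts S (@contraction_incl G S).
Proof. exact: contract_recP. Qed.

Lemma contraction_bridge (G : wgraph) (S : {set edge G}) (e : edge (contraction S)) :
  bridge (contraction_incl e) <-> bridge e.
Proof.
have [inj im surj lift res] := contractionP S.
split=> -[c cE].
  have [f fS|c' c'c] := res c.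
    rewrite cE /=; apply: contraTN fS => /eqP ->; exact: im.
  by exists c' => f; rewrite c'c cE /= (inj_eq inj).
have [c' c'S c'c] := lift c; exists c' => f /=.
have [fS|/surj[f' <-]] := boolP (f \in S).
  rewrite (negbTE (c'S _ fS)); apply/esym/eqP => fe.
  by have := im e; rewrite -/(contraction_incl e) -fe fS.
by rewrite c'c cE /= (inj_eq inj).
Qed.

Lemma is_iso_bridge (G H : wgraph) (fV : vertex G -> vertex H)
    (fE : edge G -> edge H) : is_iso fV fE ->
  forall e, bridge (fE e) <-> bridge e.
Proof.
move=> [[gV fVK gVK] bE _ inc] e.
have cutE (c : vertex H -> bool) f : cut (fun v => c (fV v)) f = cut c (fE f).
  rewrite /cut; have [[-> ->] //|[-> ->]] := inc f.
  by rewrite eq_sym.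
have [gE fEK gEK] := bE.
split=> -[c cE].
  by exists (fun v => c (fV v)) => f; rewrite cutE cE /= (can_eq fEK).
exists (fun v => c (gV v)) => f; rewrite -(gEK f) -cutE.
rewrite (_ : cut _ _ = cut c (gE f)); last by rewrite /cut !fVK.
by rewrite cE /= (can_eq fEK).
Qed.

(** * Points of the moduli space and their invariants *)

Section Points.
Variables (R : realType) (g : nat).
Implicit Types (G H : stable_graph g).

Lemma cone_abs_subproof G (x : edge (graph_of G) -> R) :
  (fun e => `|x e|) \in
    [set x : {ptws edge (graph_of G) -> R} | forall e, 0 <= x e]%classic.
Proof. by rewrite inE /= => e; exact: normr_ge0. Qed.

(** Absolute values make this a total function of the edge lengths, so that no
    positivity proof has to be carried around. *)
Definition cone_abs G (x : edge (graph_of G) -> R) : cone R G :=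
  SigSub (cone_abs_subproof x).

Definition pt G (x : edge (graph_of G) -> R) : Mtrop R g :=
  cone_map (cone_abs x).

Lemma coords_cone_abs G (x : edge (graph_of G) -> R) e :
  coords (cone_abs x) e = `|x e|.
Proof. by []. Qed.

Lemma coords_ge0 G (x : cone R G) e : 0 <= coords x e.
Proof. by have := valP x; rewrite inE /=; apply. Qed.

Lemma pt_coords G (x : cone R G) : pt (coords x) = cone_map x.
Proof.
congr (cone_map _); apply: val_inj => /=; apply/funext => e.
by apply: ger0_norm; exact: coords_ge0.
Qed.

Lemma pt_onto (p : Mtrop R g) : exists G (x : cone R G), p = cone_map x.
Proof.
rewrite -[p]reprK; case: (repr p) => G x.
by exists G, x.
Qed.

(** All that the invariants below use about an arrow of the diagram. *)
Lemma glue_stepP (p q : cones R g) : glue_step p q ->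
  exists j : edge (graph_of (projT1 q)) -> edge (graph_of (projT1 p)),
  [/\ injective j, forall e, coords (projT2 p) (j e) = coords (projT2 q) e,
      forall e, e \notin codom j -> coords (projT2 p) e = 0
    & forall e, bridge (j e) <-> bridge e].
Proof.
move=> [S [fV [fE [iso pq p0]]]].
have [inj im surj _ _] := contractionP S.
have [_ [gE fEK gEK] _ _] := iso.
exists (fun e => contraction_incl (fE e)); split=> //.
- by move=> e f /inj; exact: (can_inj fEK).
- move=> e; have [/p0 //|/surj[f <-]] := boolP (e \in S).
  case/negP; apply/codomP; by exists (gE f); rewrite gEK.
- by move=> e; apply: iff_trans (contraction_bridge _) (is_iso_bridge iso e).
Qed.

(** Equality of points is generated by the arrows of the diagram, so invariants
    need only be checked on a single arrow. *)
Lemma cone_map_invariant (T : Type) (F : cones R g -> T) :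
  (forall p q, glue_step p q -> F p = F q) ->
  forall G H (x : cone R G) (y : cone R H), cone_map x = cone_map y ->
  F (existT _ G x) = F (existT _ H y).
Proof.
move=> Fglue G H x y /eqmodP/asboolP.
by elim=> [p q /Fglue //|//|p q _ -> //|p q r _ -> _ ->].
Qed.

Definition edge_sum (phi : R -> R) (p : cones R g) : R :=
  \sum_(e : edge (graph_of (projT1 p))) phi (coords (projT2 p) e).

(** The condition at 0 makes the sum blind to the edges that are contracted. *)
Lemma edge_sum_invariant (phi : R -> R) : phi 0 = 0 ->
  forall G H (x : cone R G) (y : cone R H), cone_map x = cone_map y ->
  \sum_(e : edge (graph_of G)) phi (coords x e)
    = \sum_(e : edge (graph_of H)) phi (coords y e).
Proof.
move=> phi0 G H x y; apply: (@cone_map_invariant _ (edge_sum phi)).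
move=> p q /glue_stepP[j [inj pq p0 _]]; rewrite /edge_sum.
rewrite (bigID (mem (codom j))) /= [X in _ + X]big1 ?addr0; last first.
  by move=> e /p0 ->.
under [RHS]eq_bigr do rewrite -pq.
rewrite -(big_imset (fun e => phi (coords (projT2 p) e)) (in2W inj)).
apply: eq_bigl => e; apply/idP/idP.
  by move=> /codomP[f ->]; apply: imset_f.
by move=> /imsetP[f _ ->]; apply: codom_f.
Qed.

Definition has_bridge (p : cones R g) : Prop :=
  exists2 e, bridge e & coords (projT2 p) e != 0.

(** A bridge of length zero can be contracted away, which is why positive length
    is required. *)
Lemma has_bridge_invariant G H (x : cone R G) (y : cone R H) :
  cone_map x = cone_map y ->
  (exists2 e, bridge e & coords x e != 0) ->
  exists2 e, bridge e & coords y e != 0.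
Proof.
move=> /(@cone_map_invariant _ has_bridge) h.
suff Fglue p q : glue_step p q -> has_bridge p = has_bridge q.
  by rewrite -/(has_bridge (existT _ G x)) h.
move=> /glue_stepP[j [inj pq p0 br]]; apply/propext; split=> -[e be xe].
  have /codomP[f ef] : e \in codom j by apply: contraNT xe => /p0 ->.
  by exists f; rewrite -?br -?pq -?ef.
by exists (j e); rewrite ?br ?pq.
Qed.

End Points.

(** * Faces *)

Section Push.
Variable R : realType.

(** The linear map that sends the basis vector of [a] to that of [j a]. *)
Definition push (A B : finType) (j : A -> B) (x : A -> R) : B -> R :=
  fun b => \sum_(a | j a == b) x a.

Lemma push_comp (A B C : finType) (j : A -> B) (k : B -> C) (x : A -> R) :
  push k (push j x) = push (k \o j) x.
Proof.
apply/funext => c; rewrite /push (partition_big j (fun b => k b == c)) //=.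
apply: eq_bigr => b kb; apply: eq_bigl => a.
by case: eqP => [->|]; rewrite ?kb ?andbF.
Qed.

Lemma push_inj (A B : finType) (j : A -> B) (x : A -> R) (a : A) :
  injective j -> push j x (j a) = x a.
Proof.
by move=> inj; rewrite /push (big_pred1 a) // => b; rewrite /= (inj_eq inj).
Qed.

Lemma push_notin (A B : finType) (j : A -> B) (x : A -> R) (b : B) :
  b \notin codom j -> push j x b = 0.
Proof.
by move=> bj; apply: big_pred0 => a; apply: contraNF bj => /eqP <-; exact: codom_f.
Qed.

End Push.

(** Contracting an empty or a one-element set of edges gives the graph itself
    or the contraction of that edge, but only after the recursion bound
    [#|S|] is evaluated; the next two lemmas move isomorphisms across. *)
Lemma contraction0 (G H : wgraph) (fV : vertex G -> vertex H)
    (fE : edge G -> edge H) : is_iso fV fE ->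
  exists (fV' : vertex G -> vertex (contraction (finset.set0 : {set edge H})))
    (fE' : edge G -> edge (contraction finset.set0)),
    is_iso fV' fE' /\ forall f, contraction_incl (fE' f) = fE f.
Proof.
move=> iso; rewrite /contraction_incl /contraction finset.cards0 /=.
by exists fV, fE.
Qed.

Lemma contraction1 (G H : wgraph) (e : edge H)
    (fV : vertex G -> vertex (contract_edge e))
    (fE : edge G -> edge (contract_edge e)) : is_iso fV fE ->
  exists (fV' : vertex G -> vertex (contraction [set e]%SET))
    (fE' : edge G -> edge (contraction [set e]%SET)),
    is_iso fV' fE' /\ forall f, contraction_incl (fE' f) = val (fE f).
Proof.
rewrite /contraction_incl /contraction finset.cards1 /=.
case: pickP => [e'|/(_ e)]; last by rewrite set11.
by move=> /set1P -> /= iso; exists fV, fE.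
Qed.

Section Faces.
Variables (R : realType) (g : nat).
Implicit Types (G H : stable_graph g).

(** [G] is, up to isomorphism, a contraction of [H]; only the effect on points
    of the moduli space is recorded. *)
Definition face G H : Prop :=
  exists2 j : edge (graph_of G) -> edge (graph_of H), injective j
    & forall x : edge (graph_of G) -> R, pt x = pt (push j x).

Lemma face_trans G H K : face G H -> face H K -> face G K.
Proof.
move=> [j injj jP] [k injk kP]; exists (k \o j); first exact: inj_comp.
by move=> x; rewrite jP kP push_comp.
Qed.

Lemma glue_face G H (S : {set edge (graph_of H)})
    (fV : vertex (graph_of G) -> vertex (contraction S))
    (fE : edge (graph_of G) -> edge (contraction S))
    (x : edge (graph_of G) -> R) : is_iso fV fE ->
  pt x = pt (push (fun e => contraction_incl (fE e)) x).
Proof.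
move=> iso; set j := fun e => _; apply/esym/eqmodP/asboolP/rst_step.
have [inj im surj _ _] := contractionP S.
have [_ [gE fEK _] _ _] := iso.
have injj : injective j by move=> e f /inj; exact: (can_inj fEK).
exists S, fV, fE; split=> // e; rewrite /= !coords_cone_abs.
  by rewrite -/(j e) push_inj.
move=> eS; rewrite push_notin ?normr0 //; apply: contraL eS => /codomP[f ->].
exact: im.
Qed.

Lemma iso_pt G H (fV : vertex (graph_of G) -> vertex (graph_of H))
    (fE : edge (graph_of G) -> edge (graph_of H))
    (x : edge (graph_of G) -> R) : is_iso fV fE -> pt x = pt (push fE x).
Proof.
move=> /contraction0[fV' [fE' [/glue_face iso fEE]]]; rewrite iso.
by congr (pt (push _ x)); apply/funext.
Qed.

Lemma contract_pt G H (e : edge (graph_of H))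
    (fV : vertex (graph_of G) -> vertex (contract_edge e))
    (fE : edge (graph_of G) -> edge (contract_edge e))
    (x : edge (graph_of G) -> R) :
  is_iso fV fE -> pt x = pt (push (fun f => val (fE f)) x).
Proof.
move=> /contraction1[fV' [fE' [/glue_face iso fEE]]]; rewrite iso.
by congr (pt (push _ x)); apply/funext.
Qed.

Lemma iso_face G H (fV : vertex (graph_of G) -> vertex (graph_of H))
    (fE : edge (graph_of G) -> edge (graph_of H)) : is_iso fV fE -> face G H.
Proof.
move=> iso; have [_ /bij_inj inj _ _] := iso.
by exists fE => // x; exact: iso_pt iso.
Qed.

Lemma contract_face G H (e : edge (graph_of H))
    (fV : vertex (graph_of G) -> vertex (contract_edge e))
    (fE : edge (graph_of G) -> edge (contract_edge e)) :
  is_iso fV fE -> face G H.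
Proof.
move=> iso; have [_ /bij_inj inj _ _] := iso.
exists (fun f => val (fE f)) => [f f' /val_inj/inj //|x].
exact: contract_pt iso.
Qed.

End Faces.

(** * Stable graphs of genus two *)

Lemma adj_sym (G : wgraph) : symmetric (@adj G).
Proof.
by move=> u v; apply/existsP/existsP => -[e he]; exists e; rewrite orbC.
Qed.

Lemma ncomp_connected (G : wgraph) (v0 : vertex G) :
  (forall v, connect (@adj G) v0 v) -> ncomp G = 1%N.
Proof.
move=> h; rewrite -(n_comp_connect (sym_connect_sym (@adj_sym G)) v0).
by apply: eq_n_comp_r => v; rewrite [RHS]h.
Qed.

Lemma sum_eq_op (T : finType) (x : T) : (\sum_(y : T) (x == y) = 1)%N.
Proof.
by rewrite (bigD1 x) //= eqxx big1 // => y; rewrite eq_sym => /negbTE ->.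
Qed.

Lemma sum_valence (G : wgraph) :
  (\sum_(v : vertex G) valence v = 2 * #|edge G|)%N.
Proof.
rewrite exchange_big /= -sum1_card big_distrr /=; apply: eq_bigr => e _.
by rewrite big_split /= !sum_eq_op.
Qed.

(** The genus formula, and the sum over the vertices of the stability
    inequality, which reads 3 <= 2 w(v) + val(v) on integers.  The inequality
    is also what makes the truncated subtraction in the first Betti number
    exact. *)
Lemma stable_genus2 (G : wgraph) : stable_of_genus G 2 ->
  (#|edge G| + \sum_(v : vertex G) weight v = #|vertex G| + 1)%N /\
  (3 * #|vertex G| <= 2 * \sum_(v : vertex G) weight v + 2 * #|edge G|)%N.
Proof.
case/and3P => /eqP nc /eqP; rewrite /genus /betti1 nc => gen /forallP stab.
have bound : (3 * #|vertex G| <=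
    2 * \sum_(v : vertex G) weight v + 2 * #|edge G|)%N.
  rewrite -sum_valence -sum1_card !big_distrr -big_split /=.
  by apply: leq_sum => v _; rewrite muln1; exact: stab.
by split=> //; move: gen bound; lia.
Qed.

(** Trading one unit of weight at [v] for a loop, which becomes the last
    edge. *)
Definition add_loop (G : ograph) (v : 'I_(nvertex G)) : ograph :=
  @OGraph (nvertex G) (nedge G).+1
    (fun i => oapp (@osrc G) v (unlift ord_max i))
    (fun i => oapp (@otgt G) v (unlift ord_max i))
    (fun u => (oweight u - (u == v))%N).

Lemma lift_max_widen n (i : 'I_n) :
  widen_ord (leqnSn n) i = lift ord_max i.
Proof. by apply: val_inj; exact: esym (lift_max i). Qed.

Lemma adj_add_loop (G : ograph) (v : 'I_(nvertex G)) u w :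
  @adj (wgraph_of (add_loop v)) u w
    = @adj (wgraph_of G) u w || ((u == v) && (w == v)).
Proof.
apply/existsP/orP => [[e]|[/existsP[e he]|/andP[/eqP -> /eqP ->]]] /=.
- case: unliftP => [e' _|_] /= he; first by left; apply/existsP; exists e'.
  right; move: he; rewrite ![v == _]eq_sym.
  by case/orP => /andP[-> ->].
- by exists (lift ord_max e); rewrite /= liftK.
- by exists ord_max; rewrite /= unlift_none /= !eqxx.
Qed.

Lemma ncomp_add_loop (G : ograph) (v : 'I_(nvertex G)) :
  ncomp (wgraph_of (add_loop v)) = ncomp (wgraph_of G).
Proof.
apply: eq_n_comp => u w; apply/idP/idP; apply: connect_sub => {}u {}w.
  rewrite adj_add_loop => /orP[|/andP[/eqP -> /eqP ->]]; first exact: connect1.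
  exact: connect0.
by move=> uw; apply: connect1; rewrite adj_add_loop uw.
Qed.

Lemma valence_add_loop (G : ograph) (v u : 'I_(nvertex G)) :
  valence (u : vertex (wgraph_of (add_loop v)))
    = (valence (u : vertex (wgraph_of G)) + 2 * (u == v))%N.
Proof.
rewrite /valence /= big_ord_recr /= unlift_none /= [v == u]eq_sym; congr addn.
  by apply: eq_bigr => i _; rewrite lift_max_widen liftK.
by lia.
Qed.

Lemma weight_add_loop (G : ograph) (v : 'I_(nvertex G)) :
  (0 < oweight v)%N ->
  ((\sum_(u : vertex (wgraph_of (add_loop v))) weight u).+1
    = \sum_(u : vertex (wgraph_of G)) weight u)%N.
Proof.
move=> wv; rewrite /= (bigD1 v) //= [RHS](bigD1 v) //= eqxx.
have -> : (\sum_(i < nvertex G | i != v) (oweight i - (i == v)) =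
           \sum_(i < nvertex G | i != v) oweight i)%N.
  by apply: eq_bigr => u /negbTE ->; rewrite subn0.
by rewrite subn1 -addSn prednK.
Qed.

Lemma stable_add_loop (G : ograph) (v : 'I_(nvertex G)) :
  (0 < oweight v)%N -> stable_of_genus (wgraph_of G) 2 ->
  stable_of_genus (wgraph_of (add_loop v)) 2.
Proof.
move=> wv st; have [eqE bound] := stable_genus2 st.
case/and3P: st => /eqP nc _ /forallP stab; apply/and3P; split.
- by rewrite ncomp_add_loop nc.
- have := weight_add_loop wv; rewrite /genus /betti1 ncomp_add_loop nc.
  by move: eqE bound; rewrite /= !card_ord => eqE bound wE; lia.
- apply/forallP => u; have := stab u; rewrite valence_add_loop /=.
  by case: eqP => [->|_] /=; move: wv; lia.
Qed.

Lemma add_loop_iso (G : ograph) (v : 'I_(nvertex G)) : (0 < oweight v)%N ->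
  exists (fV : vertex (wgraph_of G) -> vertex (contract_edge
                 (ord_max : edge (wgraph_of (add_loop v)))))
         (fE : edge (wgraph_of G) -> edge (contract_edge
                 (ord_max : edge (wgraph_of (add_loop v))))),
    is_iso fV fE.
Proof.
move=> wv; pose m : edge (wgraph_of (add_loop v)) := ord_max.
have sm : src m = v by rewrite /= unlift_none.
have tm : tgt m = v by rewrite /= unlift_none.
have loop : is_loop m by rewrite /is_loop sm tm.
have vP (u : 'I_(nvertex G)) : (u != tgt m) || is_loop m by rewrite loop orbT.
have eP (i : 'I_(nedge G)) : lift ord_max i != m by rewrite eq_sym neq_lift.
have merge u : ce_merge m u = u by rewrite /ce_merge sm tm; case: eqP.
exists (fun u => exist _ u (vP u)), (fun i => exist _ (lift ord_max i) (eP i)).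
split.
- exists val => [u //|u]; exact: val_inj.
- apply: inj_card_bij => [i i' /(congr1 val) /lift_inj //|].
  by rewrite card_sig cardC1 !card_ord.
- move=> u; rewrite /= /ce_weight /= -/m loop /= unlift_none /=.
  by case: eqP => [->|_]; rewrite ?eqxx ?subn0 //; lia.
- by move=> i; left; split; apply: val_inj => /=; rewrite -/m merge liftK.
Qed.

(** A positive vertex weight is always the trace of a contracted loop. *)
Lemma weightless_face (R : realType) (G : stable_graph 2) :
  exists2 H : stable_graph 2, (forall v : vertex (graph_of H), weight v = 0%N)
    & face R G H.
Proof.
have [n] := ubnP (\sum_(v : vertex (graph_of G)) weight v)%N.
elim: n G => // n IH G; rewrite ltnS => leG.
have [/forallP w0|] := boolP [forall v : vertex (graph_of G), weight v == 0%N].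
  exists G => [v|]; first exact/eqP.
  apply: (@iso_face _ _ _ _ id id); split=> //; try by exists id.
  by move=> e; left.
rewrite negb_forall => /existsP[v]; rewrite -lt0n => wv.
pose H : stable_graph 2 := exist _ (add_loop v) (stable_add_loop wv (valP G)).
have [|K wK HK] := IH H.
  by apply: leq_trans leG; rewrite -(weight_add_loop wv).
exists K => //; apply: face_trans HK.
have [fV [fE iso]] := add_loop_iso wv; exact: (@contract_face R 2 G H ord_max fV fE iso).
Qed.

(** * The two trivalent graphs *)

Lemma ord2P (v : 'I_2) : v = ord0 \/ v = ord_max.
Proof. by case: v => [[|[|n]] h] //; [left|right]; apply: val_inj. Qed.

Lemma ord3P (P : 'I_3 -> Prop) :
  P ord0 -> P (lift ord0 ord0) -> P (lift ord0 (lift ord0 ord0)) ->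
  forall i, P i.
Proof.
move=> P0 P1 P2 [[|[|[|n]]] h] //.
- by rewrite (_ : Ordinal h = ord0) //; apply: val_inj.
- by rewrite (_ : Ordinal h = lift ord0 ord0) //; apply: val_inj.
- by rewrite (_ : Ordinal h = lift ord0 (lift ord0 ord0)) //; apply: val_inj.
Qed.

Definition theta_ograph : ograph :=
  @OGraph 2 3 (fun=> ord0) (fun=> ord_max) (fun=> 0%N).

(** The edges 0 and 1 are the loops, the last edge is the bridge. *)
Definition dumbbell_ograph : ograph :=
  @OGraph 2 3 (fun i => if i == 1%N :> nat then ord_max else ord0)
    (fun i => if i == 0%N :> nat then ord0 else ord_max) (fun=> 0%N).

Definition figure8_ograph : ograph :=
  @OGraph 1 2 (fun=> ord0) (fun=> ord0) (fun=> 0%N).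

Lemma stable_figure8 : stable_of_genus (wgraph_of figure8_ograph) 2.
Proof.
have nc : ncomp (wgraph_of figure8_ograph) = 1%N.
  apply: (@ncomp_connected (wgraph_of figure8_ograph) ord0) => v; rewrite (ord1 v : v = ord0); exact: connect0.
apply/and3P; split; first by rewrite nc.
  by rewrite /genus /betti1 nc /= !card_ord big1.
apply/forallP => v /=; rewrite /valence /= (ord1 v : v = ord0).
by rewrite !big_ord_recl big_ord0.
Qed.

Lemma stable_trivalent (s t : 'I_3 -> 'I_2) :
  s ord_max = ord0 -> t ord_max = ord_max ->
  (forall v : 'I_2, (2 < \sum_(i < 3) ((s i == v) + (t i == v)))%N) ->
  stable_of_genus (wgraph_of (@OGraph 2 3 s t (fun=> 0%N))) 2.
Proof.
move=> sm tm val3; set G := wgraph_of _.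
have nc : ncomp G = 1%N.
  apply: (@ncomp_connected G ord0) => v.
  have [->|->] := ord2P v; first exact: connect0.
  apply: connect1; apply/existsP; exists (ord_max : 'I_3).
  by rewrite /= sm tm !eqxx.
apply/and3P; split; first by rewrite nc.
  by rewrite /genus /betti1 nc /= !card_ord big1.
by apply/forallP => v; exact: val3.
Qed.

Lemma stable_theta : stable_of_genus (wgraph_of theta_ograph) 2.
Proof.
apply: stable_trivalent => // v.
by have [->|->] := ord2P v; rewrite !big_ord_recl big_ord0.
Qed.

Lemma stable_dumbbell : stable_of_genus (wgraph_of dumbbell_ograph) 2.
Proof.
apply: stable_trivalent => // v.
by have [->|->] := ord2P v; rewrite !big_ord_recl big_ord0.
Qed.

Definition theta : stable_graph 2 := exist _ theta_ograph stable_theta.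
Definition dumbbell : stable_graph 2 := exist _ dumbbell_ograph stable_dumbbell.
Definition figure8 : stable_graph 2 := exist _ figure8_ograph stable_figure8.

(** Both trivalent graphs contract to the figure eight along their last edge,
    which joins the two vertices; this is where their cones are glued. *)
Lemma figure8_contraction (s t : 'I_3 -> 'I_2) :
  let G := wgraph_of (@OGraph 2 3 s t (fun=> 0%N)) in
  s ord_max = ord0 -> t ord_max = ord_max ->
  exists (fV : vertex (graph_of figure8) ->
               vertex (contract_edge (ord_max : edge G)))
         (fE : edge (graph_of figure8) ->
               edge (contract_edge (ord_max : edge G))),
    is_iso fV fE /\ forall i : 'I_2, val (fE i) = lift ord_max i.
Proof.
move=> G sm tm; pose m : edge G := ord_max.
have v0P : (ord0 != tgt m :> 'I_2) || is_loop m by rewrite /= tm.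
pose v0 : vertex (contract_edge m) := exist _ ord0 v0P.
have v0E (v : vertex (contract_edge m)) : v = v0.
  apply: val_inj; case: v => v /=; rewrite /is_loop /= sm tm orbF.
  by have [->|->] := ord2P v; rewrite ?eqxx.
have eP (i : 'I_2) : lift ord_max i != m by rewrite eq_sym neq_lift.
exists (fun=> v0), (fun i => exist _ (lift ord_max i) (eP i)); split=> //.
split.
- by exists (fun=> ord0) => [v|v]; rewrite ?ord1 // -v0E.
- apply: inj_card_bij => [i i' /(congr1 val) /lift_inj //|].
  by rewrite card_sig cardC1 !card_ord.
- by move=> v; rewrite /= /ce_weight /is_loop /= sm tm.
- by move=> i; left; split; exact: v0E.
Qed.

Lemma figure8_theta (R : realType) (x : 'I_2 -> R) :
  pt (G := figure8) x = pt (G := theta) (push (lift ord_max) x).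
Proof.
have [fV [fE [iso fEE]]] :=
  @figure8_contraction (fun=> ord0) (fun=> ord_max) erefl erefl.
rewrite (@contract_pt R 2 figure8 theta ord_max fV fE x iso).
by congr (pt (push _ x)); apply/funext.
Qed.

Lemma figure8_dumbbell (R : realType) (x : 'I_2 -> R) :
  pt (G := figure8) x = pt (G := dumbbell) (push (lift ord_max) x).
Proof.
have [fV [fE [iso fEE]]] := @figure8_contraction
  (osrc (o := dumbbell_ograph)) (otgt (o := dumbbell_ograph)) erefl erefl.
rewrite (@contract_pt R 2 figure8 dumbbell ord_max fV fE x iso).
by congr (pt (push _ x)); apply/funext.
Qed.

(** Two vertices of valence at least 3 and three edges leave two possibilities:
    no loop at all (the theta graph), or one loop at each vertex and one edge
    between them (the dumbbell).  In the second case the displayed function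
    names the edges as in [dumbbell_ograph], sending a loop to the number of its
    vertex. *)
Lemma trivalent_iso (s t : 'I_3 -> 'I_2) :
  (forall v : 'I_2, (2 < \sum_(i < 3) ((s i == v) + (t i == v)))%N) ->
  (forall i, s i != t i) \/
  injective (fun i => if s i == t i then widen_ord (leqnSn 2) (s i) else ord_max).
Proof.
move=> val3; move: (val3 ord0) (val3 ord_max).
rewrite !big_ord_recl !big_ord0.
(* The 64 incidence patterns are inspected one by one. *)
case: (ord2P (s ord0)) => s0; case: (ord2P (t ord0)) => t0;
case: (ord2P (s (lift ord0 ord0))) => s1; case: (ord2P (t (lift ord0 ord0))) => t1;
case: (ord2P (s (lift ord0 (lift ord0 ord0)))) => s2;
case: (ord2P (t (lift ord0 (lift ord0 ord0)))) => t2;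
rewrite ?s0 ?s1 ?s2 ?t0 ?t1 ?t2 //= => _ _.
all: first [by left; apply: ord3P; rewrite ?s0 ?s1 ?s2 ?t0 ?t1 ?t2 
  | right; apply: ord3P; apply: ord3P; rewrite ?s0 ?s1 ?s2 ?t0 ?t1 ?t2 //=;
   by move=> /(congr1 val)].
Qed.

(** With all weights zero there is one edge more than there are vertices, and
    stability bounds the number of vertices by 2. *)
Lemma face_theta_or_dumbbell (R : realType) (G : stable_graph 2) :
  face R G theta \/ face R G dumbbell.
Proof.
have [H w0 GH] := weightless_face R G.
suff : face R H theta \/ face R H dumbbell.
  by case=> h; [left|right]; apply: face_trans h.
case: H w0 {GH} => -[n m s t w] st w0.
have {}w0 : w = (fun=> 0%N) by apply/funext.
subst w; have [] := stable_genus2 st.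
rewrite /= !card_ord big1 // => mn le3.
have [[n1 m2]|[n2 m3]] : (n = 1 /\ m = 2 \/ n = 2 /\ m = 3)%N.
- case: n s t st mn le3 => [|[|n]] s t st mn le3.
  + have m1 : m = 1%N by lia.
    by subst m; case: (s ord0).
  + by left; lia.
  + by right; lia.
- subst n m; left; set K : stable_graph 2 := exist _ _ _.
  apply: (@face_trans R 2 K figure8).
    apply: (@iso_face R 2 K figure8 id id); split=> //; try by exists id.
    by move=> e; left; split; exact: etrans (ord1 _) (esym (ord1 _)).
  exists (lift ord_max); first exact: lift_inj.
  by move=> x; exact: figure8_theta.
subst n m; set K : stable_graph 2 := exist _ _ _.
have [|nonloop|inj] := @trivalent_iso s t.
- by move=> v; case/and3P: (st) => _ _ /forallP /(_ v).
- left; apply: (@iso_face R 2 K theta id id); split=> //; try by exists id.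
  move=> e /=; have := nonloop e.
  by have [->|->] := ord2P (s e); have [->|->] := ord2P (t e); [|left|right|].
- right; apply: (@iso_face R 2 K dumbbell id _).
  split; first by exists id.
  + exact: injF_bij inj.
  + by [].
  move=> e /=.
  by have [->|->] := ord2P (s e); have [->|->] := ord2P (t e); [left|left|right|left].
Qed.

(** * Automorphisms act by moving edges *)

Section UnitLengths.
Variable R : realType.

Definition unit_length (A : finType) (a : A) : A -> R := fun b => (b == a)%:R.

Lemma unit_length_ge0 (A : finType) (a b : A) : 0 <= unit_length a b.
Proof. exact: ler0n. Qed.

Lemma sum_unit_length (A : finType) (a : A) : \sum_b unit_length a b = 1.
Proof.
rewrite (bigD1 a) //= /unit_length eqxx big1 ?addr0 // => b /negbTE -> //.
Qed.

Lemma push_unit_length (A B : finType) (j : A -> B) (a : A) :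
  push j (unit_length a) = unit_length (j a).
Proof.
apply/funext => b; rewrite /push big_mkcond (bigD1 a) //= big1 => [|a' /negbTE a'a].
  by rewrite /unit_length eqxx addr0 eq_sym; case: eqP.
by rewrite /unit_length a'a; case: ifP.
Qed.

Lemma pushD (A B : finType) (j : A -> B) (x y : A -> R) :
  push j (fun a => x a + y a) = (fun b => push j x b + push j y b).
Proof. by apply/funext => b; rewrite /push big_split. Qed.

Lemma push_ge0 (A B : finType) (j : A -> B) (x : A -> R) :
  (forall a, 0 <= x a) -> forall b, 0 <= push j x b.
Proof. by move=> x0 b; apply: sumr_ge0. Qed.

Lemma linear_unit_lengthE (A B : finType) (L : (A -> R) -> (B -> R)) :
  linear L -> forall x b, L x b = \sum_a x a * L (unit_length a) b.
Proof.
move=> linL x b.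
pose Llin : {linear (A -> R) -> (B -> R)} :=
  HB.pack L (GRing.isLinear.Build R (A -> R) (B -> R) _ L linL).
have {1}-> : x = \sum_a x a *: unit_length a.
  have scaleE a c : (x a *: unit_length a) c = x a * unit_length a c by [].
  apply/funext => c; rewrite fct_sumE (bigD1 c) //= big1 => [|a ac].
    by rewrite addr0 scaleE /unit_length eqxx mulr1.
  by rewrite scaleE /unit_length eq_sym (negbTE ac) mulr0.
rewrite -[L]/(Llin : _ -> _) linear_sum fct_sumE; apply: eq_bigr => a _.
by rewrite linearZ.
Qed.

End UnitLengths.

Section LengthMaps.
Variables (R : realType) (g : nat).
Implicit Types (G H : stable_graph g).

Lemma coords_nneg G (x : edge (graph_of G) -> R) :
  (forall e, 0 <= x e) -> coords (cone_abs x) = x.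
Proof.
by move=> x0; apply/funext => e; rewrite coords_cone_abs ger0_norm.
Qed.

Definition total_length (p : Mtrop R g) : R := edge_sum id (repr p).

Lemma total_length_pt G (x : edge (graph_of G) -> R) :
  (forall e, 0 <= x e) -> total_length (pt x) = \sum_e x e.
Proof.
move=> x0; rewrite -[in RHS](coords_nneg x0) /total_length /edge_sum.
case E : (repr (pt x)) => [H y] /=.
apply: (edge_sum_invariant (phi := id)) => //.
by rewrite /cone_map -E; exact: reprK.
Qed.

Lemma nat_ge1 (t : R) : t \is a Num.int -> 0 <= t -> t != 0 -> 1 <= t.
Proof.
move=> ti t0; have /natrP[[|n] ->] : t \is a Num.nat by rewrite natrEint ti.
  by rewrite eqxx.
by rewrite ler1n.
Qed.

(** [f] is given on the cone of [G] by [L]; cones are replaced by the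
    nonnegative vectors that they consist of. *)
Definition factors (f : Mtrop R g -> Mtrop R g) G H
    (L : (edge (graph_of G) -> R) -> (edge (graph_of H) -> R)) : Prop :=
  integral_linear L /\
  forall x, (forall e, 0 <= x e) ->
    (forall e, 0 <= L x e) /\ f (pt x) = pt (L x).

Lemma is_morphism_factors (f : Mtrop R g -> Mtrop R g) G :
  is_morphism f -> exists H (L : (edge (graph_of G) -> R) -> _),
    factors f (H := H) L.
Proof.
move=> [_ /(_ G)[H [L [l [iL lL fl]]]]]; exists H, L; split=> // x x0.
have LE : L x = coords (l (cone_abs x)) by rewrite lL coords_nneg.
split=> [e|]; first by rewrite LE coords_ge0.
by rewrite LE pt_coords -fl.
Qed.

(** The image of a basis vector is nonzero, since otherwise [f] would identify
    the curve with one edge of length 1 and the curve with all lengths zero;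
    and a nonzero coordinate that is a nonnegative integer is at least 1. *)
Lemma factors_unit_length (f : Mtrop R g -> Mtrop R g) G H
    (L : (edge (graph_of G) -> R) -> (edge (graph_of H) -> R)) e :
  injective f -> factors f L -> exists e', 1 <= L (unit_length R e) e'.
Proof.
move=> injf [[linL intL] Lpt].
have [u0 fu] := Lpt _ (unit_length_ge0 R e).
case: (pselect (exists e', L (unit_length R e) e' != 0)) => [[e' ne0]|all0].
  exists e'; apply: nat_ge1 => //; apply: intL => a.
  exact: natr_int.
pose z : edge (graph_of G) -> R := fun=> 0.
have z0 a : 0 <= z a by [].
have [_ fz] := Lpt z z0.
have : pt (unit_length R e) = pt z.
  apply: injf; rewrite fu fz; congr (pt _); apply/funext => e'.
  have -> : L (unit_length R e) e' = 0.
    by apply/eqP; apply: contrapT => /negP h; apply: all0; exists e'.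
  by rewrite (linear_unit_lengthE linL) big1 // => a _; rewrite mul0r.
move=> /(congr1 total_length); rewrite !total_length_pt ?sum_unit_length //.
by rewrite big1 // => /eqP; rewrite oner_eq0.
Qed.

(** Every column of the matrix of [f] on a cone has sum at least 1. *)
Lemma total_length_le (f : Mtrop R g -> Mtrop R g) (p : Mtrop R g) :
  is_morphism f -> injective f -> total_length p <= total_length (f p).
Proof.
move=> mf injf; have [G [z ->]] := pt_onto p; rewrite -pt_coords.
have z0 e : 0 <= coords z e := coords_ge0 z e.
have [H [L fL]] := is_morphism_factors G mf; have [[linL _] Lpt] := fL.
have [Lz0 ->] := Lpt _ z0; rewrite !total_length_pt //.
under [leRHS]eq_bigr do rewrite (linear_unit_lengthE linL).
rewrite exchange_big; apply: ler_sum => e _ /=.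
rewrite -mulr_sumr ler_peMr //.
have [e' Le'] := factors_unit_length e injf fL.
have [Lu0 _] := Lpt _ (unit_length_ge0 R e).
by apply: (le_trans Le'); rewrite (bigD1 e') //= lerDl sumr_ge0.
Qed.

(** Applied to an automorphism and to its inverse, the preceding inequality
    becomes an equality: every column has sum exactly 1, so it is a basis
    vector, and the linear map only moves edges. *)
Lemma automorphism_push (f : Mtrop R g -> Mtrop R g) G : is_automorphism f ->
  exists H (s : edge (graph_of G) -> edge (graph_of H)),
    forall x, (forall e, 0 <= x e) -> f (pt x) = pt (push s x).
Proof.
move=> [mf [h [mh fK hK]]].
have injf := can_inj fK; have injh := can_inj hK.
have len p : total_length (f p) = total_length p.
  apply/eqP; rewrite eq_le; apply/andP; split; last exact: total_length_le.
  by have := total_length_le (f p) mh injh; rewrite fK.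
have [H [L fL]] := is_morphism_factors G mf; have [[linL _] Lpt] := fL.
exists H.
have /choice[s sE] e : exists e', L (unit_length R e) = unit_length R e'.
  have [e' Le'] := factors_unit_length e injf fL; exists e'.
  have [Lu0 fu] := Lpt _ (unit_length_ge0 R e).
  have := len (pt (unit_length R e)); rewrite fu (total_length_pt Lu0).
  rewrite (total_length_pt (unit_length_ge0 R e)) sum_unit_length (bigD1 e') //= => sum1.
  have rest0 : 0 <= \sum_(i | i != e') L (unit_length R e) i by exact: sumr_ge0.
  have rest : \sum_(i | i != e') L (unit_length R e) i = 0 by lra.
  apply/funext => e''; rewrite /unit_length -/(unit_length R e).
  have [->|ne] := eqVneq e'' e'; first by move: sum1; rewrite rest addr0.
  by move/eqP: rest; rewrite psumr_eq0 // => /allP/(_ e'' (mem_index_enum _));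
    rewrite ne => /eqP.
exists s => x x0; have [_ ->] := Lpt x x0; congr (pt _); apply/funext => b.
rewrite (linear_unit_lengthE linL) /push [RHS]big_mkcond; apply: eq_bigr => a _.
by rewrite sE /unit_length eq_sym; case: eqP => _; rewrite ?mulr1 ?mulr0.
Qed.

(** If two edges had the same image, one edge of length 2 and two edges of
    length 1 would be identified; the number of edges of positive length tells
    them apart. *)
Lemma push_injective (f : Mtrop R g -> Mtrop R g) G H
    (s : edge (graph_of G) -> edge (graph_of H)) : injective f ->
  (forall x, (forall e, 0 <= x e) -> f (pt x) = pt (push s x)) -> injective s.
Proof.
move=> injf fs i j sij; apply: contrapT => /eqP nij.
(* [x i] is a single edge of length 2, [x j] is two edges of length 1. *)
pose x k (e : edge (graph_of G)) : R := unit_length R i e + unit_length R k e.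
have x0 k e : 0 <= x k e by apply: addr_ge0; exact: unit_length_ge0.
have /edge_sum_invariant : pt (x i) = pt (x j).
  by apply: injf; rewrite !fs // !pushD !push_unit_length sij.
move=> /(_ (fun t => (t != 0)%:R)); rewrite eqxx => /(_ erefl).
rewrite !coords_nneg // => E.
have two e : (x j e != 0)%:R = unit_length R i e + unit_length R j e :> R.
  rewrite /x /unit_length; have [->|ei] := eqVneq e i.
    by rewrite (negbTE nij) addr0 oner_eq0.
  by case: (e == j); rewrite ?add0r ?oner_eq0 ?eqxx.
have one e : (x i e != 0)%:R = unit_length R i e :> R.
  rewrite /x /unit_length; case: (e == i); last by rewrite addr0 eqxx.
  by rewrite -natrD pnatr_eq0.
move: E; under eq_bigr do rewrite one.
under [RHS]eq_bigr do rewrite two.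
by rewrite big_split /= !sum_unit_length; lra.
Qed.

End LengthMaps.

(** * Triviality of the automorphism group *)

Lemma bridge_dumbbell : @bridge (graph_of dumbbell) (ord_max : 'I_3).
Proof.
exists (fun v : 'I_2 => v == ord_max).
by apply: (@ord3P (fun i => cut _ (i : edge (graph_of dumbbell)) = _)).
Qed.

(** The three edges of the theta graph are parallel, so a cut contains all of
    them or none. *)
Lemma no_bridge_theta (e : edge (graph_of theta)) : ~ bridge e.
Proof.
move=> [c cE].
have := erefl (cut c (ord0 : edge (graph_of theta))).
rewrite {1}(_ : cut c _ = cut c (ord_max : edge (graph_of theta))) // !cE /=.
have := erefl (cut c (ord0 : edge (graph_of theta))).
rewrite {1}(_ : cut c _ = cut c (lift ord0 ord0 : edge (graph_of theta))) // !cE /=.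
by case: e {cE} => -[|[|[|m]]].
Qed.

Section Main.
Variable R : realType.

Definition thetapt (x : 'I_3 -> R) : Mtrop R 2 := pt (G := theta) x.
Definition dumbbellpt (x : 'I_3 -> R) : Mtrop R 2 := pt (G := dumbbell) x.

Lemma thetapt_perm (s : 'I_3 -> 'I_3) (x : 'I_3 -> R) : injective s ->
  thetapt (push s x) = thetapt x.
Proof.
move=> inj; apply/esym; apply: (@iso_pt R 2 theta theta id s x).
by split=> // [||e]; [exists id|exact: injF_bij|left].
Qed.

Lemma dumbbellpt_perm (s : 'I_3 -> 'I_3) (x : 'I_3 -> R) : injective s ->
  s ord_max = ord_max -> dumbbellpt (push s x) = dumbbellpt x.
Proof.
move=> inj sm; apply/esym.
(* A permutation that swaps the two loops must swap the vertices. *)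
pose fV (v : 'I_2) : 'I_2 := if s ord0 == ord0 then v else rev_ord v.
apply: (@iso_pt R 2 dumbbell dumbbell fV s x).
split=> //.
- by rewrite /fV; case: (s ord0 == ord0); [exists id|exists (@rev_ord 2); exact: rev_ordK].
- exact: injF_bij.
have n0 : s ord0 <> ord_max by rewrite -sm => /inj.
have n1 : s (lift ord0 ord0) <> ord_max by rewrite -sm => /inj.
have n01 : s ord0 <> s (lift ord0 ord0) by move=> /inj.
have m2 : lift ord0 (lift ord0 ord0) = ord_max :> 'I_3 by apply: val_inj.
have max2 : rev_ord ord0 = ord_max :> 'I_2 by apply: val_inj.
have max0 : rev_ord ord_max = ord0 :> 'I_2 by apply: val_inj.
rewrite /fV; apply: (@ord3P (fun i => let e := i : edge (graph_of dumbbell) in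
  _ \/ _)); rewrite ?m2 ?sm; move: n0 n1 n01.
all: pattern (s ord0); apply: ord3P; rewrite ?m2 // => _.
all: pattern (s (lift ord0 ord0)); apply: ord3P; rewrite ?m2 // => _ _ /=.
all: rewrite ?max2 ?max0; by [left|right].
Qed.

(** A single loop is a face of the figure eight, hence of both trivalent
    graphs. *)
Lemma thetapt_dumbbellpt (i : 'I_3) : i != ord_max ->
  thetapt (unit_length R i) = dumbbellpt (unit_length R i).
Proof.
rewrite eq_sym => /unlift_some[k -> _].
rewrite -(push_unit_length R (lift ord_max) k).
by rewrite /thetapt -figure8_theta figure8_dumbbell.
Qed.

Lemma dumbbellpt_bridge (x : 'I_3 -> R) :
  dumbbellpt (unit_length R ord_max) <> thetapt x.
Proof.
move=> /has_bridge_invariant[|e be _]; last exact: no_bridge_theta be.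
exists (ord_max : 'I_3); first exact: bridge_dumbbell.
by rewrite coords_nneg; [rewrite /unit_length eqxx oner_eq0|exact: unit_length_ge0].
Qed.

Lemma thetapt_unit_length (i j : 'I_3) :
  thetapt (unit_length R i) = thetapt (unit_length R j).
Proof.
by rewrite -(thetapt_perm _ (@perm_inj _ (tperm i j))) push_unit_length tpermL.
Qed.

Lemma automorphism_trivalent (f : Mtrop R 2 -> Mtrop R 2) G :
  is_automorphism f ->
  exists2 s : edge (graph_of G) -> 'I_3, injective s
    & (forall x, (forall e, 0 <= x e) -> f (pt x) = thetapt (push s x)) \/
      (forall x, (forall e, 0 <= x e) -> f (pt x) = dumbbellpt (push s x)).
Proof.
move=> af; have [H [s fs]] := automorphism_push G af.
have [_ [h [_ fK _]]] := af.
have injs := push_injective (can_inj fK) fs.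
have [[j injj jP]|[j injj jP]] := face_theta_or_dumbbell R H.
- exists (j \o s); first exact: inj_comp.
  by left => x x0; rewrite fs // jP push_comp.
- exists (j \o s); first exact: inj_comp.
  by right => x x0; rewrite fs // jP push_comp.
Qed.

(** If the cone of the theta graph went to that of the dumbbell, its edges
    would be permuted onto those of the dumbbell, one of them onto the bridge.
    But the rays of the theta cone are all the same in the moduli space, and the
    bridge and the loops of the dumbbell are different rays. *)
Lemma automorphism_theta (f : Mtrop R 2 -> Mtrop R 2) (x : 'I_3 -> R) :
  is_automorphism f -> (forall e, 0 <= x e) -> f (thetapt x) = thetapt x.
Proof.
move=> af; have [s injs [fs|fs]] := automorphism_trivalent theta af => x0.
  by rewrite /thetapt fs // thetapt_perm.
have [t _ tK] := injF_bij injs.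
have [j nj] : exists j, j != t ord_max.
  by exists (lift (t ord_max) ord0); rewrite eq_sym neq_lift.
have sj : s j != ord_max by rewrite -(tK ord_max) (inj_eq injs).
have E k : f (thetapt (unit_length R k)) = dumbbellpt (unit_length R (s k)).
  by rewrite /thetapt fs ?push_unit_length //; exact: unit_length_ge0.
have := E (t ord_max).
rewrite tK (thetapt_unit_length _ j) E -thetapt_dumbbellpt // => /esym.
by move=> /dumbbellpt_bridge.
Qed.

(** The rays of the theta graph being fixed, injectivity keeps the bridge of the
    dumbbell away from them, so the bridge goes to the bridge and the loops to
    the loops; exchanging the loops is an automorphism of the dumbbell. *)
Lemma automorphism_dumbbell (f : Mtrop R 2 -> Mtrop R 2) (x : 'I_3 -> R) :
  is_automorphism f -> (forall e, 0 <= x e) -> f (dumbbellpt x) = dumbbellpt x.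
Proof.
move=> af x0; have [_ [h [_ fK _]]] := af; have injf := can_inj fK.
have bridge_ne k : f (dumbbellpt (unit_length R ord_max)) <>
    thetapt (unit_length R k).
  rewrite -(automorphism_theta af (unit_length_ge0 R k)) => /injf.
  exact: dumbbellpt_bridge.
have [s injs [fs|fs]] := automorphism_trivalent dumbbell af.
  by case: (bridge_ne (s ord_max)); rewrite /dumbbellpt fs ?push_unit_length.
rewrite /dumbbellpt fs // dumbbellpt_perm //.
apply: contrapT => /eqP sm; case: (bridge_ne (s ord_max)).
by rewrite thetapt_dumbbellpt // {1}/dumbbellpt fs ?push_unit_length.
Qed.

Lemma is_morphism_id g : is_morphism (fun p : Mtrop R g => p).
Proof.
split=> [p|G]; first exact: cvg_id.
by exists G, id, id; split=> //; split=> // a u v.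
Qed.

End Main.

Theorem mainTheorem3 (R : realType) :
  Mtrop_aut R 2 = [set (fun x : Mtrop R 2 => x)]%classic.
Proof.
apply/seteqP; split=> f /=; last first.
  move=> ->; split; first exact: is_morphism_id.
  by exists id; split=> //; exact: is_morphism_id.
move=> af; apply/funext => p.
have [G [z ->]] := pt_onto p; rewrite -pt_coords.
have [[j _ ->]|[j _ ->]] := face_theta_or_dumbbell R G.
- by apply: automorphism_theta => //; apply: push_ge0 => e; exact: coords_ge0.
- by apply: automorphism_dumbbell => //; apply: push_ge0 => e; exact: coords_ge0.
Qed.
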